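(* Assume $s>2c$, and let $f^*=f^{(s-c)}$ be the voting rule with parameter $r=s-c$ (thresholds $a=b\to\infty$). Then for every admissible attack $g$, $$\gamma(f^*,g)\ge (s-2c)\,I,$$ where $I=\min\{I_0,I_1\}$.
   Context: A binary state $\theta\in\{0,1\}$ is observed by $s$ sensors indexed by $\mathcal{S}=\{1,\dots,s\}$; at each time $k\in\mathbb{Z}^+$ sensor $i$ produces a real observation $x_i(k)$. Let $\mu,\nu$ be mutually absolutely continuous Borel probability measures on $\mathbb{R}$. Under $\mathbb{P}_\theta$ all $x_i(k)$ are independent, with law $\nu$ if $\theta=0$ and $\mu$ if $\theta=1$. Let $I_1=\int\log\frac{d\mu}{d\nu}\,d\mu$, $I_0=-\int\log\frac{d\mu}{d\nu}\,d\nu$, assumed $0<I_0,I_1<\infty$, and $I=\min\{I_0,I_1\}$. Attack model: an attacker compromises a fixed set $\mathcal{C}\subseteq\mathcal{S}$ with $|\mathcal{C}|=c$ (the detector knows $c$ but not $\mathcal{C}$). The fusion center receives $x'(k)=x(k)+x^a(k)$, where $x^a(k)\in\mathbb{R}^s$, the union over $k$ of the supports of $x^a(k)$ equals $\mathcal{C}$, and $x^a(k)=g(X_{\mathcal{C}}(k),X^a(k-1),\theta,k)$ is a measurable (possibly randomized) function of the true observations of the compromised sensors up to time $k$, the previously injected vectors, the true state $\theta$, and $k$. Such $g$ is an admissible attack; $\mathbb{P}^g_\theta,\mathbb{E}^g_\theta$ denote probability and expectation of the manipulated observations. A detection strategy is $f=(f_1,f_2,\dots)$ with $f_k$ mapping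 $x'(1),\dots,x'(k)$ to $\{\text{continue},0,1\}$; stopping time $T$ is the first $k$ with $f_k\neq\text{continue}$, decision $f_T$. With $\alpha=\mathbb{P}^g_0[f_T=1]$, $\beta=\mathbb{P}^g_1[f_T=0]$, $D(T)=\max_\theta\mathbb{E}^g_\theta[T]$, the performance is $\gamma(f,g)=\lim_{\alpha=\beta\to0^+}\frac{\log(1/\alpha)}{D(T)}$, the limit taken along the family of tests for which $\alpha=\beta\to0$. Voting rule $f^{(r)}$ ($s/2<r\le s$): with $S_i(n)=\sum_{k=1}^n\log\frac{d\mu}{d\nu}(x'_i(k))$ computed from the received observations, thresholds $a,b>0$, let $\tau^+_i(b)=\inf\{k:S_i(k)\ge b\}$, $\tau^-_i(a)=\inf\{k:S_i(k)\le -a\}$, and $\tau^\pm_{(j)}$ the $j$-th smallest of these over $i\in\mathcal{S}$. The rule stops at $\min\{\tau^-_{(r)}(a),\tau^+_{(r)}(b)\}$, deciding $0$ if $\tau^-_{(r)}(a)<\tau^+_{(r)}(b)$, $1$ if $\tau^+_{(r)}(b)<\tau^-_{(r)}(a)$, and $0$ or $1$ with probability $1/2$ each if equal. *)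

(* Defs.v *)
From HB Require Import structures.
From mathcomp Require Import all_boot all_order all_algebra.
From mathcomp Require Import all_classical all_reals all_analysis.

Set Implicit Arguments.
Unset Strict Implicit.
Unset Printing Implicit Defensive.

Import Order.TTheory GRing.Theory Num.Theory.
Import numFieldNormedType.Exports.
Local Open Scope classical_set_scope.
Local Open Scope ring_scope.

Section Defs.
Context {R : realType} {d : measure_display} {Omega : measurableType d}.
Context {s : nat}.

Definition is_RN_deriv (mu nu : set R -> \bar R) (L : R -> R) : Prop :=
  measurable_fun setT L /\ (forall y, 0 <= L y) /\
  (forall A, measurable A -> mu A = (\int[nu]_(y in A) (L y)%:E)%E).

Definition llr (L : R -> R) (y : R) : R := ln (L y).

Definition mutually_independent {I : eqType} (P : probability Omega R)
    (Y : I -> Omega -> R) : Prop :=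
  forall (F : seq I) (B : I -> set R), uniq F -> (forall j, measurable (B j)) ->
    P (\bigcap_(j in [set j | j \in F]) (Y j @^-1` B j)) =
    (\prod_(j <- F) P (Y j @^-1` B j))%E.

(* the family consisting of the attacker's randomness U (index None) and
   all sensor observations x i k (index Some (i,k)); time k : nat is the
   (k+1)-th observation instant *)
Definition obs_family (x : 'I_s -> nat -> Omega -> R) (U : Omega -> R)
    (j : option ('I_s * nat)) : Omega -> R :=
  match j with None => U | Some (i, k) => x i k end.

(* generators of the information available to the attacker at time k:
   its randomness U and the true observations of compromised sensors up
   to time k *)
Definition attacker_info (C : {set 'I_s}) (x : 'I_s -> nat -> Omega -> R)
    (U : Omega -> R) (k : nat) : set (set Omega) :=
  [set S | (exists B, measurable B /\ S = U @^-1` B) \/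
           (exists i m B, i \in C /\ (m <= k)%N /\ measurable B /\
                          S = x i m @^-1` B)].

(* admissible attack: supported exactly on C, and x^a(k) is a (measurable,
   possibly randomized) function of the compromised observations up to time k *)
Definition admissible_attack (C : {set 'I_s}) (x : 'I_s -> nat -> Omega -> R)
    (U : Omega -> R) (xa : nat -> Omega -> 'I_s -> R) : Prop :=
  (forall k w i, i \notin C -> xa k w i = 0) /\
  (forall w i, i \in C -> exists k, xa k w i != 0) /\
  (forall k i B, measurable B ->
     <<s attacker_info C x U k >> ((fun w => xa k w i) @^-1` B)).

Definition received (x : 'I_s -> nat -> Omega -> R) (xa : nat -> Omega -> 'I_s -> R)
    (i : 'I_s) (k : nat) (w : Omega) : R := x i k w + xa k w i.

Definition Ssum (L : R -> R) (x' : 'I_s -> nat -> Omega -> R) (i : 'I_s)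
    (n : nat) (w : Omega) : R :=
  \sum_(k < n) llr L (x' i k w).

(* tau^+_i(b) <= n, tau^-_i(a) <= n *)
Definition crossed_up L x' b i n w : Prop :=
  exists m, (0 < m <= n)%N /\ b <= Ssum L x' i m w.
Definition crossed_dn L x' a i n w : Prop :=
  exists m, (0 < m <= n)%N /\ Ssum L x' i m w <= - a.

(* r-th smallest of the tau^+_i(b) (resp. tau^-_i(a)), in \bar R (+oo if
   fewer than r sensors ever cross) *)
Definition tau_up_r L x' (r : nat) (b : R) (w : Omega) : \bar R :=
  ereal_inf [set (n%:R)%:E | n in
    [set n : nat | (r <= #|[set i : 'I_s | `[< crossed_up L x' b i n w >]]|)%N]].
Definition tau_dn_r L x' (r : nat) (a : R) (w : Omega) : \bar R :=
  ereal_inf [set (n%:R)%:E | n in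
    [set n : nat | (r <= #|[set i : 'I_s | `[< crossed_dn L x' a i n w >]]|)%N]].

Definition vote_T L x' r a b (w : Omega) : \bar R :=
  Order.min (tau_dn_r L x' r a w) (tau_up_r L x' r b w).

(* probability of deciding 1 (ties broken by a fair coin) *)
Definition vote_P_decide1 (P : probability Omega R) L x' r a b : \bar R :=
  (P [set w | (tau_up_r L x' r b w < tau_dn_r L x' r a w)%E] +
   (2^-1)%:E * P [set w | tau_up_r L x' r b w = tau_dn_r L x' r a w /\
                          (tau_up_r L x' r b w < +oo)%E])%E.

Definition vote_P_decide0 (P : probability Omega R) L x' r a b : \bar R :=
  (P [set w | (tau_dn_r L x' r a w < tau_up_r L x' r b w)%E] +
   (2^-1)%:E * P [set w | tau_up_r L x' r b w = tau_dn_r L x' r a w /\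
                          (tau_up_r L x' r b w < +oo)%E])%E.

End Defs.

(* Main.v *)
(** Only the honest sensors matter, and Chernoff bounds suffice for them. Under
    [theta = 0] the log-likelihood sums of the honest sensors are independent random
    walks whose steps have exponential moment [phi k = \int L^k dnu]. Since [phi] has
    derivative [- I_0] at [0], [phi k <= 1 - k (I - delta)] for small [k > 0]; since
    [\int L^(1-k) dnu = \int L^(-k) dmu], the same bound holds for [phi (1 - k)].
    A wrong decision requires [s - 2c] honest walks to reach [t] at some time, which
    the tilt [1 - k] bounds by [O(exp (- (1 - k) (s - 2c) t))]. The rule has stopped
    as soon as all [s - c] honest walks are below [- t], and the tilt [k] bounds the
    expected time until then by [t / (I - delta) + O(1)]. The state [theta = 1] is the
    state [theta = 0] with [mu] and [nu] exchanged and [L] replaced by [1 / L]. *)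
Require Import Defs.
From HB Require Import structures.
From mathcomp Require Import all_boot all_order all_algebra.
From mathcomp Require Import all_classical all_reals all_analysis.
From mathcomp Require Import measurable_realfun ring lra.
Import Order.TTheory GRing.Theory Num.Theory.
Import numFieldNormedType.Exports.
Local Open Scope classical_set_scope.
Local Open Scope ring_scope.

(** * Densities and products of independent variables *)

(** With [phi = id] this is the change of measure formula for the density [w]; with
    [phi] a random variable independent of [w], [k] is the law of [phi] scaled by the
    expectation of [w]. *)
Section Density.
Context d1 d2 (X : measurableType d1) (T : measurableType d2) (R : realType).
Variables (P : {measure set X -> \bar R}) (k : {measure set T -> \bar R}).
Variables (phi : X -> T) (w : X -> R).
Hypothesis mphi : measurable_fun setT phi.
Hypothesis mw : measurable_fun setT w.
Hypothesis w0 : forall x, 0 <= w x.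
Hypothesis kE : forall B, measurable B ->
  k B = (\int[P]_(x in phi @^-1` B) (w x)%:E)%E.

Import HBNNSimple.

(** A simple function is a finite combination of indicators of its level sets, and for such an
    indicator the identity is [kE]. *)
Lemma nnsfun_integral_density (h : {nnsfun T >-> R}) :
  (\int[k]_y (h y)%:E = \int[P]_x ((h (phi x))%:E * (w x)%:E))%E.
Proof.
have mpre B : measurable B -> measurable (phi @^-1` B).
  by move=> mB; rewrite -[X in measurable X]setTI; exact: mphi.
transitivity (\int[P]_x (\sum_(y \in range h)
    y%:E * (\1_(phi @^-1` (h @^-1` [set y])) x * w x)%:E))%E; last first.
  apply: eq_integral => x _.
  rewrite -EFinM (fimfunE h) mulrC fsbig_distrr// -fsumEFin//.
  by apply: eq_fsbigr => y _; rewrite -EFinM; congr EFin; rewrite mulrA mulrC.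
rewrite ge0_integral_fsum//; first last.
(* Here [y] is any real, possibly negative; outside the range of [h] the indicator vanishes. *)
- move=> y x _; rewrite -EFinM lee_fin mulrA mulr_ge0//.
  case: (eqVneq (h (phi x)) y) => [<-|/eqP hy]; first by rewrite mulr_ge0.
  by rewrite indicE memNset ?mulr0.
- move=> y; apply/measurable_EFinP; apply: measurable_funM => //.
  apply: measurable_funM => //; apply: measurable_indic; exact: mpre.
transitivity (\sum_(y \in range h) y%:E * k (h @^-1` [set y]))%E.
  by rewrite integralT_nnsfun sintegralE.
apply: eq_fsbigr => y; rewrite inE => -[x _ <-].
rewrite kE; last exact: measurable_funPTI.
have mh : measurable (phi @^-1` (h @^-1` [set h x])) by apply: mpre; exact: measurable_funPTI.
rewrite ge0_integralZl ?lee_fin//; first last.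
- by move=> z _; rewrite lee_fin mulr_ge0.
- apply/measurable_EFinP; apply: measurable_funM => //; exact: measurable_indic.
congr (_ * _)%E; rewrite [LHS]integral_mkcond; apply: eq_integral => z _.
by rewrite epatch_indic/= -EFinM mulrC.
Qed.

(** Monotone convergence on both sides, along simple functions increasing to [h]. *)
Lemma ge0_integral_density (h : T -> \bar R) :
  measurable_fun setT h -> (forall y, 0 <= h y)%E ->
  (\int[k]_y h y = \int[P]_x (h (phi x) * (w x)%:E))%E.
Proof.
move=> mh h0; pose g := nnsfun_approx measurableT mh.
have gh y : (g n y)%:E @[n --> \oo] --> h y by exact: cvg_nnsfun_approx.
have ndg y : {homo (fun n => (g n y)%:E) : n m / (n <= m)%N >-> (n <= m)%E}.
  by move=> n m nm; rewrite lee_fin; exact/lefP/nd_nnsfun_approx.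
transitivity (limn (fun n => \int[k]_y (g n y)%:E)%E).
  rewrite -monotone_convergence//.
  - by apply: eq_integral => y _; apply/esym/cvg_lim.
  - by move=> n; exact/measurable_EFinP.
  - by move=> n y _; rewrite lee_fin.
under eq_fun do rewrite nnsfun_integral_density.
rewrite -monotone_convergence//.
- apply: eq_integral => x _; apply/cvg_lim => //.
  by apply: cvgeZr.
- move=> n; apply: emeasurable_funM; last exact/measurable_EFinP.
  by apply/measurable_EFinP; exact: measurableT_comp.
- by move=> n x _; rewrite mule_ge0 ?lee_fin.
- by move=> x _ n m nm; rewrite lee_wpmul2r ?lee_fin//; exact: ndg.
Qed.
End Density.

Section Independence.
Context d (Omega : measurableType d) (R : realType) (P : probability Omega R).
Context (I : eqType) (Y : I -> Omega -> R) (m : probability R R).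
Context (g : R -> R) (e : R).
Hypothesis mY : forall j, measurable_fun setT (Y j).
Hypothesis indY : mutually_independent P Y.
Hypothesis lawY : forall j B, measurable B -> P (Y j @^-1` B) = m B.
Hypothesis mg : measurable_fun setT g.
Hypothesis g0 : forall y, 0 <= g y.
Hypothesis gE : (\int[m]_y (g y)%:E = e%:E)%E.

Let mpreY j B : measurable B -> measurable (Y j @^-1` B).
Proof. by move=> mB; rewrite -[X in measurable X]setTI; exact: mY. Qed.

(** Independence is given for events only, so the factors [g] are introduced one at a time. The
    indicators over [F2] strengthen the induction: moving an index [i] from [F1] to [F2] yields the
    law of [Y i] weighted by the other factors. *)
Lemma expectation_prod_indic (F1 F2 : seq I) (B : I -> set R) :
  uniq (F1 ++ F2) -> (forall j, measurable (B j)) ->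
  (\int[P]_w (\prod_(j <- F1) g (Y j w) * \prod_(j <- F2) \1_(B j) (Y j w))%:E =
   (e ^+ size F1 * \prod_(j <- F2) fine (m (B j)))%:E)%E.
Proof.
elim: F1 F2 B => [|i F1 IH] F2 B /= uF mB.
  transitivity (P (\bigcap_(j in [set j | j \in F2]) (Y j @^-1` B j))).
    rewrite -[LHS](_ : (\int[P]_w
        (\1_(\bigcap_(j in [set j | j \in F2]) (Y j @^-1` B j)) w)%:E)%E = _).
      rewrite integral_indic ?setIT//.
      apply: fin_bigcap_measurable => [|j _]; last exact: mpreY.
      by apply/finite_seqP; exists F2.
    apply: eq_integral => w _; congr EFin; rewrite big_nil mul1r.
    rewrite indicE; case: (boolP (w \in _)) => [|].
      rewrite inE => h; rewrite big_seq big1// => j jF.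
      by rewrite indicE mem_set//; exact: h.
    move/negP; rewrite inE => h.
    have [j jF jB] : exists2 j, j \in F2 & ~ B j (Y j w).
      by apply: contra_notP h => /forall2NP h j /= jF; have [|/contrapT] := h j.
    by rewrite (big_rem j)//= indicE memNset// mul0r.
  rewrite indY// mul1r -prodEFin; apply: eq_bigr => j _.
  by rewrite lawY// fineK// fin_num_measure.
have /andP[iF uF'] := uF; move: iF; rewrite mem_cat negb_or => /andP[iF1 iF2].
pose c := e ^+ size F1 * \prod_(j <- F2) fine (m (B j)).
have e0 : 0 <= e.
  by rewrite -lee_fin -gE; apply: integral_ge0 => w _; rewrite lee_fin.
have c0 : 0 <= c.
  by apply: mulr_ge0; [exact: exprn_ge0|apply: prodr_ge0 => // j _; exact: fine_ge0].
pose w x := \prod_(j <- F1) g (Y j x) * \prod_(j <- F2) \1_(B j) (Y j x).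
have mw : measurable_fun setT w.
  apply: measurable_funM; apply: measurable_prod => j _.
    exact: measurableT_comp.
  by apply: measurableT_comp => //; exact: measurable_indic.
have w0 x : 0 <= w x by rewrite /w mulr_ge0//; apply: prodr_ge0.
(* The law of [Y i] weighted by [w], which the induction hypothesis identifies as a multiple of
   [m]. *)
pose k := mscale (NngNum c0) m.
have kE A : measurable A -> k A = (\int[P]_(x in Y i @^-1` A) (w x)%:E)%E.
  move=> mA; pose B' j := if j == i then A else B j.
  have B'i : B' i = A by rewrite /B' eqxx.
  have B'E : {in F2, B' =1 B}.
    by move=> j jF; rewrite /B'; case: eqP jF iF2 => // -> ->.
  have /= := IH (i :: F2) B'; rewrite big_cons B'i => IHi.
  rewrite [RHS]integral_mkcond epatch_indic.
  transitivity (\int[P]_w (\prod_(j <- F1) g (Y j w) *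
      \prod_(j <- (i :: F2)) \1_(B' j) (Y j w))%:E)%E; last first.
    apply: eq_integral => x _ /=; rewrite -EFinM /w; congr EFin.
    rewrite big_cons B'i -mulrA; congr (_ * _); rewrite mulrC; congr (_ * _).
    by rewrite !big_seq; apply: eq_bigr => j jF; rewrite B'E.
  rewrite IHi; first last.
  - by move=> j; rewrite /B'; case: ifP.
  - by rewrite -cat1s uniq_catCA.
  rewrite /k/mscale/= /c; have -> : \prod_(j <- F2) fine (m (B' j)) =
      \prod_(j <- F2) fine (m (B j)).
    by rewrite !big_seq; apply: eq_bigr => j jF; rewrite B'E.
  rewrite mulrCA [RHS]EFinM [RHS]muleC fineK//; exact: fin_num_measure.
transitivity (\int[k]_y (g y)%:E)%E.
  rewrite (@ge0_integral_density _ _ _ _ _ P k (Y i) w)//.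
  - by apply: eq_integral => x _; rewrite -EFinM big_cons /w mulrA.
  - exact/measurable_EFinP.
rewrite ge0_integral_mscale//.
- by rewrite gE /= -EFinM /c exprS mulrC mulrA.
- exact/measurable_EFinP.
- by move=> y _; rewrite lee_fin.
Qed.

Lemma expectation_prod (F : seq I) : uniq F ->
  (\int[P]_w (\prod_(j <- F) g (Y j w))%:E = (e ^+ size F)%:E)%E.
Proof.
move=> uF; have := @expectation_prod_indic F [::] (fun=> setT).
rewrite cats0 => /(_ uF (fun=> measurableT)); rewrite big_nil mulr1 => <-.
by apply: eq_integral => w _; rewrite big_nil mulr1.
Qed.
End Independence.

(** * Exponential moments of the log-likelihood ratio *)

Section ExpDifferenceQuotient.
Context (R : realType).
Implicit Types z : R.

Lemma bernoulli_ineq (x : R) n : -1 <= x -> 1 + n%:R * x <= (1 + x) ^+ n.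
Proof.
move=> x1; elim: n => [|n IH]; first by rewrite mul0r addr0 expr0.
rewrite exprSr; apply: (@le_trans _ _ ((1 + n%:R * x) * (1 + x))); last first.
  by rewrite ler_wpM2r//; lra.
rewrite -natr1; have : 0 <= n%:R * (x * x) :> R by rewrite mulr_ge0// -expr2 sqr_ge0.
nra.
Qed.

(** This is the difference quotient of [h |-> expR (h * z)] at [0] with step [1 / n.+1]. The lower
    bound here and the upper bound that follows are free of [n], as dominated convergence
    requires. *)
Lemma le_expR_quotient z n : z <= n.+1%:R * (expR (z / n.+1%:R) - 1).
Proof.
have n0 : 0 < n.+1%:R :> R by [].
rewrite -ler_pdivrMl// mulrC lerBrDl; exact: expR_ge1Dx.
Qed.

(** Bernoulli's inequality for the increment [expR (z / n.+1%:R) - 1] and the exponent [n.+1]. *)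
Lemma expR_quotient_le z n : n.+1%:R * (expR (z / n.+1%:R) - 1) <= expR z - 1.
Proof.
rewrite lerBrDl.
have -> : expR z = (1 + (expR (z / n.+1%:R) - 1)) ^+ n.+1.
  by rewrite addrC subrK -expRM_natr divfK.
by apply: bernoulli_ineq; rewrite lerBrDl subrr expR_ge0.
Qed.

Lemma cvg_expR_quotient z :
  n.+1%:R * (expR (z / n.+1%:R) - 1) @[n --> \oo] --> z.
Proof.
have zn : 1 - z / n.+1%:R @[n --> \oo] --> (1 : R).
  rewrite -[X in _ --> X](subr0 1) -[X in _ --> _ - X](mulr0 z).
  by apply: cvgB; [exact: cvg_cst|apply: cvgMr; exact: cvg_harmonic].
apply: (@squeeze_cvgr _ _ _ _ (fun=> z) (fun n => z * (1 - z / n.+1%:R)^-1)).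
- near=> n; rewrite le_expR_quotient/=.
  have h0 : 0 < 1 - z / n.+1%:R.
    by near: n; apply: cvgr_gt; [exact: zn|].
  have n0 : 0 < n.+1%:R :> R by [].
  rewrite ler_pdivlMr//.
  (* This is [1 - u <= expR (- u)] for [u = z / n.+1]; it gives [(expR u - 1) * (1 - u) <= u]. *)
  have : expR (z / n.+1%:R) * (1 - z / n.+1%:R) <= 1.
    rewrite -ler_pdivlMl ?expR_gt0// mulr1 -expRN; exact: expR_ge1Dx.
  have : z = n.+1%:R * (z / n.+1%:R) by rewrite mulrCA divff ?mulr1.
  set u := z / _ => {1}->; set e := expR u => eu.
  rewrite -mulrA ler_pM2l//; nra.
- exact: cvg_cst.
- rewrite -[X in _ --> X]mulr1; apply: cvgMr; rewrite -[X in _ --> X]invr1.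
  by apply: cvgV => //; exact: oner_neq0.
Unshelve. all: by end_near. Qed.

End ExpDifferenceQuotient.

Lemma integral_prob_cst d (T : measurableType d) (R : realType)
  (m : probability T R) (r : R) : (\int[m]__ r%:E = r%:E)%E.
Proof.
have -> : (\int[m]__ r%:E = r%:E * m setT)%E by exact: integral_cst.
by rewrite -[RHS]mule1; congr (_ * _)%E; exact: probability_setT.
Qed.

Section SmallTilt.
Context d (T : measurableType d) (R : realType) (m : probability T R) (z : T -> R).
Hypothesis iz : m.-integrable setT (fun y => (z y)%:E).
Hypothesis ez : (\int[m]_y (expR (z y))%:E < +oo)%E.

(** The exponential moment has the mean of [z] as its right derivative at [0], by dominated
    convergence of the difference quotients. The integrability of [z] and the finite moment at [1]
    supply the dominating function. *)
Lemma small_tilt (delta : R) : 0 < delta -> \forall n \near \oo,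
  (\int[m]_y (expR (z y / n.+1%:R))%:E <=
   (1 + n.+1%:R^-1 * (fine (\int[m]_y (z y)%:E) + delta))%:E)%E.
Proof.
move=> d0; pose h n y := n.+1%:R * (expR (z y / n.+1%:R) - 1).
have mz : measurable_fun setT z by apply/measurable_EFinP; exact: measurable_int iz.
have me n : measurable_fun setT (fun y => expR (z y / n.+1%:R)).
  by apply: measurableT_comp => //; exact: measurable_funM.
have mh n : measurable_fun setT (h n).
  by apply: measurable_funM => //; exact: measurable_funB.
pose g y := `|z y| + (expR (z y) + 1).
have ie : m.-integrable setT (fun y => (expR (z y))%:E).
  apply/integrableP; split.
    by apply/measurable_EFinP; exact: measurableT_comp.
  by under eq_integral do rewrite gee0_abs ?lee_fin ?expR_ge0//.
have ig : m.-integrable setT (EFin \o g).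
  apply: (@integrableD _ _ _ _ _ measurableT
    (fun y => `|z y|%:E) (fun y => (expR (z y) + 1)%:E)).
    exact: integrable_norm.
  apply: (@integrableD _ _ _ _ _ measurableT
    (fun y => (expR (z y))%:E) (cst 1%E)) => //.
  exact: finite_measure_integrable_cst.
have hg n y : `|h n y| <= g y.
  have := le_expR_quotient _ (z y) n; have := expR_quotient_le _ (z y) n.
  rewrite -/(h n y) /g => h1 h2; have := expR_ge0 (z y).
  have := ler_norm (z y); have := ler_norm (- z y); rewrite normrN.
  by rewrite ler_norml => *; apply/andP; split; lra.
have ih n : m.-integrable setT (EFin \o h n).
  apply: le_integrable ig => //; first exact/measurable_EFinP.
  by move=> y _ /=; rewrite lee_fin (le_trans (hg n y))// ler_norm.
have aecvg : {ae m, forall y, setT y -> (EFin \o h n) y @[n --> \oo] --> (EFin \o z) y}.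
  apply: aeW => y _; apply: cvg_EFin; first exact: nearW.
  exact: cvg_expR_quotient.
have aeg : {ae m, forall y n, setT y -> (`|(EFin \o h n) y| <= (EFin \o g) y)%E}.
  by apply: aeW => y n _; rewrite lee_fin.
have mhE n : measurable_fun setT (EFin \o h n) by exact/measurable_EFinP.
have mzE : measurable_fun setT (EFin \o z) by exact/measurable_EFinP.
have [_ _ cvgh] := dominated_convergence measurableT mhE mzE aecvg ig aeg.
have fz : (\int[m]_y (z y)%:E)%E \is a fin_num by apply: integrable_fin_num => //.
have fh n : (\int[m]_y (h n y)%:E)%E \is a fin_num.
  by apply: integrable_fin_num => //; exact: ih.
have {}cvgh : fine (\int[m]_y (h n y)%:E)%E @[n --> \oo] --> fine (\int[m]_y (z y)%:E)%E.
  by apply: fine_cvg; rewrite fineK.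
near=> n.
have n0 : 0 < n.+1%:R :> R by [].
have -> : (\int[m]_y (expR (z y / n.+1%:R))%:E =
    \int[m]_y (1 + n.+1%:R^-1%:E * (h n y)%:E))%E.
  apply: eq_integral => y _; rewrite -EFinM -EFinD; congr EFin.
  by rewrite /h mulKf ?gt_eqF// addrC subrK.
rewrite integralD//; first last.
- by apply: integrableZl => //; exact: ih.
- exact: finite_measure_integrable_cst.
rewrite integralZl//; last exact: ih.
rewrite integral_prob_cst.
rewrite -(fineK (fh n)) -EFinM -EFinD lee_fin lerD2l ler_pM2l ?invr_gt0//.
apply/ltW; near: n; apply: cvgr_lt; [exact: cvgh|by rewrite ltrDl].
Unshelve. all: by end_near. Qed.
End SmallTilt.

Section LikelihoodRatio.
Context (R : realType) (mu nu : probability R R) (L : R -> R).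
Hypothesis nu_mu : forall A, measurable A -> mu A = 0%E -> nu A = 0%E.
Hypothesis LE : is_RN_deriv mu nu L.

Lemma measurable_llr : measurable_fun setT (llr L).
Proof.
have [mL _] := LE; apply: measurableT_comp => //; exact: measurable_ln.
Qed.

(** The zero set of [L] is [mu]-null because [L] integrates to [0] over it, hence [nu]-null. Outside
    it [expR (llr L y)] is [L y], whatever the default value of [ln] at [0]. *)
Lemma ae_RN_deriv_gt0 : {ae nu, forall y, 0 < L y}.
Proof.
have [mL [L0 LA]] := LE.
have mA : measurable (L @^-1` [set 0]).
  by rewrite -[X in measurable X]setTI; exact: mL.
exists (L @^-1` [set 0]); split => //.
  apply: nu_mu => //; rewrite LA//; apply: integral0_eq => y /= ->//.
by move=> y /= /negP; rewrite -leNgt => Ly; apply/eqP; rewrite eq_le Ly L0.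
Qed.

(** The change of measure multiplies the integrand by [L], which is [expR (llr L y)] almost
    everywhere. The cases [k = 0] and [k = 1] yield the finite moments at [1] that [small_tilt] asks
    for. *)
Lemma tilt_duality (k : R) :
  (\int[mu]_y (expR (- (k * llr L y)))%:E = \int[nu]_y (expR ((1 - k) * llr L y))%:E)%E.
Proof.
have [mL [L0 LA]] := LE; have ml := measurable_llr.
rewrite (@ge0_integral_density _ _ _ _ _ nu mu id L)//; first last.
- apply/measurable_EFinP; apply: measurableT_comp => //.
  by apply: measurableT_comp => //; exact: measurable_funM.
apply: ae_eq_integral => //.
- apply/measurable_EFinP; apply: measurable_funM => //.
  apply: measurableT_comp => //.
  by apply: measurableT_comp => //; exact: measurable_funM.
- apply/measurable_EFinP; apply: measurableT_comp => //.
  exact: measurable_funM.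
apply: filterS ae_RN_deriv_gt0 => y Ly _; rewrite -EFinM; congr EFin.
rewrite -[X in _ * X](lnK Ly) -expRD -/(llr L y); congr expR; ring.
Qed.

Lemma expectation_expR_llr : (\int[nu]_y (expR (llr L y))%:E = 1)%E.
Proof.
have := tilt_duality 0; rewrite subr0.
under eq_integral do rewrite mul0r oppr0 expR0.
rewrite integral_prob_cst => ->.
by apply: eq_integral => y _; rewrite mul1r.
Qed.

Lemma expectation_expR_Nllr : (\int[mu]_y (expR (- llr L y))%:E = 1)%E.
Proof.
have := tilt_duality 1; rewrite subrr.
under [in RHS]eq_integral do rewrite mul0r expR0.
rewrite integral_prob_cst => <-.
by apply: eq_integral => y _; rewrite mul1r.
Qed.

End LikelihoodRatio.

(** * Crossing times *)

Lemma sum_geometric_le (R : realFieldType) (e : R) n : 0 <= e < 1 ->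
  \sum_(k < n) e ^+ k <= (1 - e)^-1.
Proof.
move=> /andP[e0 e1]; rewrite -[leRHS]mul1r ler_pdivlMr ?subr_gt0//.
rewrite mulrC -opprB mulNr -subrX1 opprB gerBl; exact: exprn_ge0.
Qed.

Section CrossingTimes.
Context {R : realType} {d : measure_display} {Omega : measurableType d} {s : nat}.
Implicit Types (L : R -> R) (z : 'I_s -> nat -> Omega -> R).

(** The voting times count the elements of a classical set; the finite set gives access to the
    lemmas on cardinals. *)
Lemma card_asbool (p : 'I_s -> Prop) :
  #|[set i : 'I_s | `[<p i>]]%classic| = #|finset (fun i => `[<p i>])|.
Proof.
apply: eq_card => i; rewrite [RHS]finset.in_set.
by apply/idP/idP => [/set_mem//|/mem_set].
Qed.

(** Stands for [1 / L]; unlike [(L y)^-1], it has log-likelihood [- llr L y] for every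
    [L y], by the convention [ln x = 0] for [x <= 0]. *)
Definition reciprocal L y := expR (- llr L y).

Lemma llrV L y : llr (reciprocal L) y = - llr L y.
Proof. exact: expRK. Qed.

Lemma SsumV L z i n w :
  Ssum (reciprocal L) z i n w = - Ssum L z i n w.
Proof. by rewrite /Ssum -sumrN; apply: eq_bigr => k _; rewrite llrV. Qed.

Lemma crossed_upV L z b i n w :
  crossed_up (reciprocal L) z b i n w = crossed_dn L z b i n w.
Proof.
apply/propext; split=> -[m [mn h]]; exists m; split=> //; move: h;
  by rewrite SsumV lerNr.
Qed.

Lemma crossed_dnV L z b i n w :
  crossed_dn (reciprocal L) z b i n w = crossed_up L z b i n w.
Proof.
apply/propext; split=> -[m [mn h]]; exists m; split=> //; move: h;
  by rewrite SsumV lerN2.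
Qed.

Lemma tau_up_rV L z r b w :
  tau_up_r (reciprocal L) z r b w = tau_dn_r L z r b w.
Proof.
rewrite /tau_up_r /tau_dn_r; congr ereal_inf; congr image.
by apply: eq_set => n; under eq_set do rewrite crossed_upV//.
Qed.

Lemma tau_dn_rV L z r b w :
  tau_dn_r (reciprocal L) z r b w = tau_up_r L z r b w.
Proof.
rewrite /tau_up_r /tau_dn_r; congr ereal_inf; congr image.
by apply: eq_set => n; under eq_set do rewrite crossed_dnV//.
Qed.

Section Measurability.
Variables (L : R -> R) (z : 'I_s -> nat -> Omega -> R).
Hypothesis mL : measurable_fun setT L.
Hypothesis mx : forall i k, measurable_fun setT (z i k).

Lemma measurable_Ssum i n : measurable_fun setT (Ssum L z i n).
Proof.
apply: measurable_sum => k; apply: measurableT_comp; last exact: mx.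
by apply: measurableT_comp => //; exact: measurable_ln.
Qed.

Lemma measurable_crossed_up b i n : measurable [set w | crossed_up L z b i n w].
Proof.
rewrite (_ : [set _ | _] =
  \bigcup_(m in [set m | (0 < m <= n)%N]) (Ssum L z i m @^-1` `[b, +oo[)).
  apply: bigcup_measurable => m _; rewrite -[X in measurable X]setTI.
  exact: measurable_Ssum.
apply/seteqP; split=> w /= [m]; first by case=> mn h; exists m => //=; rewrite in_itv/= h.
by move=> /= mn; rewrite in_itv/= andbT => h; exists m.
Qed.

Lemma measurable_tau_up_cond r b n :
  measurable [set w | (r <= #|[set i : 'I_s | `[< crossed_up L z b i n w >]]|)%N].
Proof.
(* The number of crossing sensors as a sum of indicators: the event becomes the preimage of a
   half-line. *)
pose F w := \sum_(i < s) \1_[set w | crossed_up L z b i n w] w : R.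
rewrite (_ : [set _ | _] = F @^-1` `[r%:R, +oo[).
  rewrite -[X in measurable X]setTI.
  suff mF : measurable_fun setT F by exact: mF.
  by apply: measurable_sum => i; apply: measurable_indic; exact: measurable_crossed_up.
have FE w : F w = #|[set i : 'I_s | `[< crossed_up L z b i n w >]]|%:R.
  rewrite card_asbool -sum1_card big_mkcond /= natr_sum; apply: eq_bigr => i _.
  rewrite indicE finset.in_set; case: asboolP => h; first by rewrite mem_set.
  by rewrite memNset.
by apply/seteqP; split=> w /=; rewrite FE in_itv/= andbT ler_nat.
Qed.

Lemma measurable_tau_up_r r b : measurable_fun setT (tau_up_r L z r b).
Proof.
pose E n := [set w | (r <= #|[set i : 'I_s | `[< crossed_up L z b i n w >]]|)%N].
(* The index set of the infimum depends on [w]; the value [+oo] off [E n] turns it into an infimum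
   over all [n]. *)
pose f n w := if `[<E n w>] then (n%:R)%:E else +oo%E : \bar R.
rewrite (_ : tau_up_r L z r b = fun w => einfs (f ^~ w) 0).
  apply: measurable_fun_einfs => n.
  apply: measurable_fun_ifT => //.
  apply: (measurable_fun_bool true).
  rewrite setTI (_ : _ @^-1` _ = E n); first exact: measurable_tau_up_cond.
  by apply/seteqP; split=> w /= /asboolP.
apply/funext => w; apply/eqP; rewrite eq_le; apply/andP; split.
- apply: le_ereal_inf_tmp => _ [n _ <-]; rewrite /f; case: asboolP => [En|_]; last exact: leey.
  by apply: ereal_inf_lbound; exists n.
- apply: le_ereal_inf_tmp => _ [n En <-]; apply: ge_ereal_inf.
  by exists (f n w); [exists n|rewrite /f asboolT].
Qed.

End Measurability.

Lemma measurable_tau_dn_r L z r b : measurable_fun setT L ->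
  (forall i k, measurable_fun setT (z i k)) ->
  measurable_fun setT (tau_dn_r L z r b).
Proof.
move=> mL mx; rewrite (_ : tau_dn_r L z r b = tau_up_r (reciprocal L) z r b).
  apply: measurable_tau_up_r => //; apply: measurableT_comp => //.
  apply: measurableT_comp => //; apply: measurableT_comp => //; exact: measurable_ln.
by apply/funext => w; rewrite tau_up_rV.
Qed.

End CrossingTimes.

(** * Chernoff bounds for the crossing times of independent walks *)

Section ChernoffBounds.
Context {R : realType} {d : measure_display} {Omega : measurableType d} {s : nat}.
Variables (P : probability Omega R) (L : R -> R) (z : 'I_s -> nat -> Omega -> R).
Variables (H : {set 'I_s}) (k e : R).
Hypothesis mL : measurable_fun setT L.
Hypothesis mz : forall i n, measurable_fun setT (z i n).
Hypothesis k0 : 0 < k.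
Hypothesis e01 : 0 <= e < 1.
(** Independence across the sensors of [H] enters through this identity. Each walk has its own time
    [f i], since the sensors cross at different times. *)
Hypothesis tiltE : forall f : 'I_s -> nat,
  (\int[P]_w (\prod_(i in H) expR (k * Ssum L z i (f i) w))%:E =
   (\prod_(i in H) e ^+ f i)%:E)%E.

Let mexpS i n : measurable_fun setT (fun w => expR (k * Ssum L z i n w)).
Proof.
apply: measurableT_comp => //; apply: measurable_funM => //; exact: measurable_Ssum.
Qed.

Let mexpP (f : 'I_s -> nat) :
  measurable_fun setT (fun w => \prod_(i in H) expR (k * Ssum L z i (f i) w)).
Proof.
under eq_fun do rewrite -big_enum.
by apply: measurable_prod => i _; exact: mexpS. Qed.

(** The maximum over time of each exponential is at most its sum over time, whose expectation is a
    geometric sum; hence a bound free of [n]. Markov's inequality then concludes. *)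
Lemma crossed_by_le r b n : 0 <= b ->
  (P [set w | (r <= #|[set i : 'I_s | `[< crossed_up L z b i n w >]]|)%N] <=
   (expR (- (k * (r - #|~: H|)%:R * b)) * (1 - e)^-1 ^+ #|H|)%:E)%E.
Proof.
move=> b0; set E := [set w | _]; set q := (r - _)%N.
have mE : measurable E by exact: measurable_tau_up_cond.
(* Every factor of [G] is at least [1], by its term [j = 0], and at least [expR (k * b)]
   if sensor [i] has crossed; expanding the product gives the expectation of [G]. *)
pose G w := \prod_(i in H) \sum_(j < n.+1) expR (k * Ssum L z i j w).
(* Here [f] chooses one time for each sensor of [H]; it is [ord0] elsewhere, so that each choice
   occurs once. *)
have GE w : G w = \sum_(f in pffun_on ord0 H predT)
    \prod_(i in H) expR (k * Ssum L z i (f i : 'I_n.+1) w).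
  exact: big_distr_big.
have mG : measurable_fun setT G.
  rewrite (_ : G = fun w => \sum_(f <- enum (pffun_on ord0 H predT))
    \prod_(i in H) expR (k * Ssum L z i (f i : 'I_n.+1) w)).
    by apply: measurable_sum => f; exact: mexpP.
  by apply/funext => w; rewrite GE big_enum.
have G0 w : 0 <= G w by apply: prodr_ge0 => i _; apply: sumr_ge0 => j _; exact: expR_ge0.
have EG : (\int[P]_w (G w)%:E <= ((1 - e)^-1 ^+ #|H|)%:E)%E.
  have -> : (\int[P]_w (G w)%:E = \int[P]_w (\sum_(f <- enum (pffun_on ord0 H predT))
      (\prod_(i in H) expR (k * Ssum L z i (f i : 'I_n.+1) w))%:E))%E.
    by apply: eq_integral => w _; rewrite GE sumEFin big_enum.
  rewrite ge0_integral_sum//; first last.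
  - by move=> f w _; rewrite lee_fin; apply: prodr_ge0 => i _; exact: expR_ge0.
  - by move=> f; apply/measurable_EFinP; exact: mexpP.
  under eq_bigr do rewrite tiltE.
  rewrite sumEFin lee_fin big_enum /=.
  (* The same distributivity read backwards recovers a product of geometric sums. *)
  rewrite -(big_distr_big ord0 (mem H) predT (fun i (j : 'I_n.+1) => e ^+ j)).
  rewrite prodr_const; apply: lerXn2r; rewrite ?nnegrE.
  - by apply: sumr_ge0 => j _; rewrite exprn_ge0//; case/andP: e01.
  - by rewrite invr_ge0 subr_ge0 ltW//; case/andP: e01.
  - exact: sum_geometric_le.
have EGw w : E w -> expR (k * q%:R * b) <= G w.
  move=> Ew; pose A := finset (fun i => `[< crossed_up L z b i n w >]).
  (* At most [#|~: H|] of the sensors that have crossed lie outside [H]. *)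
  have qA : (q <= #|A :&: H|)%N.
    rewrite /q leq_subLR; apply: (leq_trans Ew); rewrite card_asbool -/A.
    by rewrite -(cardsID H A) addnC leq_add2r subset_leq_card// finset.setDE finset.subsetIr.
  have GA : G w >= \prod_(i in H) (if i \in A then expR (k * b) else 1).
    apply: ler_prod => i _; apply/andP; split.
      by case: ifP => // _; exact: expR_ge0.
    case: ifPn => [|_].
      rewrite finset.in_set => /asboolP[m [/andP[_ mn] bm]].
      rewrite (bigD1 (Ordinal (mn : (m < n.+1)%N)))//=.
      apply: (@le_trans _ _ (expR (k * Ssum L z i m w))).
        by rewrite ler_expR ler_pM2l.
      by rewrite lerDl; apply: sumr_ge0 => j _; exact: expR_ge0.
    rewrite big_ord_recl /= /Ssum big_ord0 mulr0 expR0 lerDl.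
    by apply: sumr_ge0 => j _; exact: expR_ge0.
  apply: le_trans GA; rewrite -big_mkcondr /= prodr_const -expRM_natr.
  rewrite ler_expR [k * b]mulrC mulrAC mulrC ler_wpM2l ?ler_nat//.
    by rewrite mulr_ge0// ltW.
  apply: (leq_trans qA); apply: subset_leq_card; apply/fintype.subsetP => i.
  by rewrite finset.in_setI andbC unfold_in.
have -> : P E = (\int[P]_w (\1_E w)%:E)%E by rewrite integral_indic// setIT.
rewrite EFinM; apply: (@le_trans _ _ (\int[P]_w ((expR (- (k * q%:R * b)))%:E * (G w)%:E))%E).
  apply: ge0_le_integral => //.
  - by apply/measurable_EFinP; exact: measurable_indic.
  - by apply: emeasurable_funM => //; exact/measurable_EFinP.
  move=> w _; rewrite -EFinM lee_fin indicE; case: (boolP (w \in E)) => [|_].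
    by move/set_mem/EGw; rewrite expRN -ler_pdivrMl ?invr_gt0 ?expR_gt0// invrK mulr1.
  by rewrite mulr_ge0// expR_ge0.
rewrite ge0_integralZl//.
- by rewrite lee_pmul2l// ?fin_numE// lte_fin expR_gt0.
- exact/measurable_EFinP.
- by move=> w _; rewrite lee_fin.
Qed.

(** Continuity from below: the events of [crossed_by_le] increase with [n], and their bound does not
    depend on [n]. *)
Lemma tau_up_fin_le r b : 0 <= b ->
  (P [set w | (tau_up_r L z r b w < +oo)%E] <=
   (expR (- (k * (r - #|~: H|)%:R * b)) * (1 - e)^-1 ^+ #|H|)%:E)%E.
Proof.
move=> b0.
pose E n := [set w | (r <= #|[set i : 'I_s | `[< crossed_up L z b i n w >]]|)%N].
have mE n : measurable (E n) by exact: measurable_tau_up_cond.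
have -> : [set w | (tau_up_r L z r b w < +oo)%E] = \bigcup_n E n.
  apply/seteqP; split=> w /=.
    move=> /ereal_inf_lt[_ [n En _] _]; by exists n.
  move=> [n _ En]; apply: (@le_lt_trans _ _ (n%:R)%:E); last exact: ltry.
  by apply: ereal_inf_lbound; exists n.
have ndE : {homo E : n m / (n <= m)%N >-> (n <= m)%O}.
  move=> n m nm; apply/subsetPset => w; rewrite /E /= !card_asbool => h.
  apply: leq_trans h _; rewrite subset_leq_card//; apply/fintype.subsetP => i.
  rewrite !finset.in_set => /asboolP[j [/andP[j0 jn] h]]; apply/asboolP; exists j.
  by rewrite j0 (leq_trans jn nm).
have cE := @nondecreasing_cvg_mu _ _ _ P E mE (bigcupT_measurable E mE) ndE.
rewrite -(cvg_lim _ cE)//; apply: lime_le; first by apply/cvg_ex; eexists; exact: cE.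
by apply: nearW => n; exact: crossed_by_le.
Qed.

(** All other sensors are taken at time [0], where the walk is [0] and the factor is [1]. *)
Let tilt1 i n : i \in H ->
  (\int[P]_w (expR (k * Ssum L z i n w))%:E = (e ^+ n)%:E)%E.
Proof.
move=> iH; have := tiltE (fun j => if j == i then n else 0%N).
rewrite (bigD1 i)//= eqxx big1 ?mulr1 => [<-|j /andP[_ /negPf->]]; last by rewrite expr0.
apply: eq_integral => w _; rewrite (bigD1 i)//= eqxx big1 ?mulr1// => j /andP[_ /negPf->].
by rewrite /Ssum big_ord0 mulr0 expR0.
Qed.

(** The sensors of [H] suffice to reach [r] votes. The time [n0] is left free; once
    [expR (k * t) * e ^+ n0 <= 1], the second term is bounded uniformly in [t]. *)
Lemma integral_tau_dn_le r t n0 : (r <= #|H|)%N -> (0 < n0)%N ->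
  (\int[P]_w tau_dn_r L z r t w <=
   (n0%:R + #|H|%:R * expR (k * t) * e ^+ n0 * (1 - e)^-1)%:E)%E.
Proof.
move=> rH n00.
(* All sensors of [H] are below [- t] at time [n0 + n] as soon as [a n w < 1], so the
   delay after [n0] is at most the number of initial terms [a n w >= 1]. *)
pose a n w := \sum_(i in H) expR (k * (Ssum L z i (n0 + n) w + t)).
have aE n w : a n w = expR (k * t) * \sum_(i in H) expR (k * Ssum L z i (n0 + n) w).
  by rewrite mulr_sumr; apply: eq_bigr => i _; rewrite -expRD; congr expR; ring.
have a0 n w : 0 <= a n w by apply: sumr_ge0 => i _; exact: expR_ge0.
have ma n : measurable_fun setT (a n).
  rewrite (_ : a n = fun w => expR (k * t) *
    \sum_(i <- enum H) expR (k * Ssum L z i (n0 + n) w)).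
    by apply: measurable_funM => //; apply: measurable_sum => i; exact: mexpS.
  by apply/funext => w; rewrite aE big_enum.
have [e0 e1] := andP e01.
have sumn1 n : n%:R = \sum_(0 <= j < n) 1 :> R by rewrite sumr_const_nat subn0.
have le_tau w : (tau_dn_r L z r t w <= n0%:R%:E + \sum_(n <oo) (a n w)%:E)%E.
  have [[n an]|/forallNP nan] := pselect (exists n, a n w < 1).
    have exn : exists n, a n w < 1 by exists n.
    case: (ex_minnP exn) => {an exn}n an minn.
    apply: (@le_trans _ _ (n0 + n)%:R%:E).
      apply: ereal_inf_lbound; exists (n0 + n)%N => //=; rewrite card_asbool.
      apply: (leq_trans rH); rewrite subset_leq_card//; apply/fintype.subsetP => i iH.
      rewrite finset.in_set; apply/asboolP; exists (n0 + n)%N.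
      rewrite leqnn addn_gt0 n00; split=> //.
      have : expR (k * (Ssum L z i (n0 + n) w + t)) < 1.
        apply: le_lt_trans an; rewrite /a (bigD1 i)//= lerDl.
        by apply: sumr_ge0 => j _; exact: expR_ge0.
      by rewrite -expR0 ltr_expR pmulr_rlt0// => h; lra.
    rewrite natrD EFinD; apply: leeD => //.
    apply: (@le_trans _ _ (\sum_(0 <= j < n) (a j w)%:E)%E); last first.
      by apply: nneseries_lim_ge => j _ _; rewrite lee_fin.
    rewrite sumEFin lee_fin sumn1.
    rewrite big_nat [leRHS]big_nat; apply: ler_sum => j /andP[_ jn].
    by rewrite leNgt; apply/negP => /minn; rewrite leqNgt jn.
  (* No term is below [1], so the series diverges and the bound is trivial. *)
  suff -> : (\sum_(n <oo) (a n w)%:E = +oo)%E by rewrite addey// leey.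
  apply/eqyP => A A0; have [N AN] : exists N, A <= N%:R.
    by exists (Num.truncn A).+1; apply/ltW; exact: truncnS_gt.
  apply: (@le_trans _ _ (\sum_(0 <= j < N) (a j w)%:E)%E); last first.
    by apply: nneseries_lim_ge => j _ _; rewrite lee_fin.
  rewrite sumEFin lee_fin (le_trans AN)// sumn1.
  by apply: ler_sum => j _; rewrite leNgt; apply/negP; exact: nan.
have mser : measurable_fun setT (fun w => \sum_(n <oo) (a n w)%:E)%E.
  apply: ge0_emeasurable_sum.
  - by move=> n w _ _; rewrite lee_fin.
  - by move=> n _; apply/measurable_EFinP.
apply: (@le_trans _ _ (\int[P]_w (n0%:R%:E + \sum_(n <oo) (a n w)%:E))%E).
  apply: ge0_le_integral => //.
  - by move=> w _; apply: le_ereal_inf_tmp => _ [n _ <-]; rewrite lee_fin.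
  - exact: measurable_tau_dn_r.
  - by apply: emeasurable_funD.
rewrite ge0_integralD//; first last.
- by move=> w _; apply: nneseries_ge0 => n _ _; rewrite lee_fin.
rewrite integral_prob_cst EFinD leeD2l//.
rewrite integral_nneseries//; first last.
- by move=> n w _; rewrite lee_fin.
- by move=> n; apply/measurable_EFinP.
apply: lime_le.
  by apply: is_cvg_nneseries => n _ _; apply: integral_ge0 => w _; rewrite lee_fin.
apply: nearW => N /=.
have Ea n : (\int[P]_w (a n w)%:E = (#|H|%:R * expR (k * t) * e ^+ n0 * e ^+ n)%:E)%E.
  transitivity (\int[P]_w (\sum_(i <- enum H)
      (expR (k * t) * expR (k * Ssum L z i (n0 + n) w))%:E))%E.
    by apply: eq_integral => w _; rewrite aE sumEFin big_enum mulr_sumr.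
  rewrite ge0_integral_sum//; first last.
  - by move=> i; apply/measurable_EFinP; apply: measurable_funM => //; exact: mexpS.
  rewrite big_enum /= (eq_bigr (fun=> (expR (k * t) * e ^+ (n0 + n))%:E)); last first.
    move=> i iH; under eq_integral do rewrite EFinM.
    rewrite ge0_integralZl//; first by rewrite tilt1.
    by apply/measurable_EFinP; exact: mexpS.
  by rewrite sumEFin sumr_const exprD -[in LHS]mulr_natl !mulrA.
under eq_bigr do rewrite Ea.
rewrite sumEFin lee_fin -mulr_sumr ler_wpM2l//.
  by rewrite !mulr_ge0 ?expR_ge0 ?exprn_ge0.
by rewrite big_mkord; apply: sum_geometric_le.
Qed.

End ChernoffBounds.

(** * The voting rule under attack *)

(** Under the change of measure the integrand becomes [reciprocal L y * L y], which is [1] wherever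
    [L y > 0], hence [nu]-almost everywhere. *)
Lemma is_RN_deriv_reciprocal (R : realType) (mu nu : probability R R) (L : R -> R) :
  (forall A, measurable A -> mu A = 0%E -> nu A = 0%E) ->
  is_RN_deriv mu nu L -> is_RN_deriv nu mu (reciprocal L).
Proof.
move=> nu_mu LE; have [mL [L0 LA]] := LE; have ml := measurable_llr _ _ _ _ LE.
have mrL : measurable_fun setT (reciprocal L).
  by apply: measurableT_comp => //; exact: measurableT_comp.
split=> //; split=> [y|A mA]; first exact: expR_ge0.
rewrite integral_mkcond epatch_indic.
rewrite (@ge0_integral_density _ _ _ _ _ nu mu id L)//; first last.
- by move=> y; rewrite mule_ge0// lee_fin// expR_ge0.
- apply: emeasurable_funM; first exact/measurable_EFinP.
  by apply/measurable_EFinP; exact: measurable_indic.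
transitivity (\int[nu]_y (\1_A y)%:E)%E; first by rewrite integral_indic// setIT.
apply: ae_eq_integral => //.
- by apply/measurable_EFinP; exact: measurable_indic.
- apply: emeasurable_funM; last exact/measurable_EFinP.
  apply: emeasurable_funM; first exact/measurable_EFinP.
  by apply/measurable_EFinP; exact: measurable_indic.
apply: filterS (ae_RN_deriv_gt0 _ _ _ _ nu_mu LE) => y Ly _.
rewrite /= /reciprocal /llr -lnV ?posrE//.
rewrite lnK ?posrE ?invr_gt0// -!EFinM; congr EFin.
by rewrite mulrAC mulVf ?mul1r// gt_eqF.
Qed.

Section Model.
Context {R : realType} {d : measure_display} {Omega : measurableType d} {s : nat}.

Lemma mutually_independent_obs (P : probability Omega R)
    (x : 'I_s -> nat -> Omega -> R) (U : Omega -> R) :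
  mutually_independent P (obs_family x U) ->
  mutually_independent P (fun j : 'I_s * nat => x j.1 j.2).
Proof.
move=> ind F B uF mB.
pose B' (o : option ('I_s * nat)) := if o is Some j then B j else setT.
have uF' : uniq (map Some F) by rewrite map_inj_uniq// => ? ? [].
have mB' o : measurable (B' o) by case: o => [j|] /=; [exact: mB|exact: measurableT].
have := ind (map Some F) B' uF' mB'; rewrite big_map => h.
transitivity (\prod_(j <- F) P (obs_family x U (Some j) @^-1` B' (Some j)))%E.
  rewrite -h; congr (P _); apply/seteqP; split=> w /= hw.
    by move=> _ /mapP[[i k] jF ->]; exact: (hw (i, k)).
  by move=> [i k] jF; apply: (hw (Some (i, k))); exact: map_f.
by apply: eq_bigr => -[].
Qed.

(** The generators of the attacker's information are measurable events, hence so are all events of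
    the sigma-algebra that they generate. *)
Lemma measurable_received (C : {set 'I_s}) (x : 'I_s -> nat -> Omega -> R)
    (U : Omega -> R) (xa : nat -> Omega -> 'I_s -> R) i k :
  (forall i k, measurable_fun setT (x i k)) -> measurable_fun setT U ->
  admissible_attack C x U xa -> measurable_fun setT (received x xa i k).
Proof.
move=> mx mU [_ [_ mxa]]; apply: measurable_funD => // _ B mB; rewrite setTI.
have := mxa k i B mB; apply: smallest_sub; first exact: sigma_algebra_measurable.
move=> _ [[B' [mB' ->]]|[j [m [B' [_ [_ [mB' ->]]]]]]]; rewrite -[X in measurable X]setTI.
- exact: mU.
- exact: mx.
Qed.

(** A decision [1], by a strict win or by a tie, needs a finite [tau_up_r]. The factor [2] is
    harmless for the exponent. *)
Lemma vote_decide1_le (P : probability Omega R) L (z : 'I_s -> nat -> Omega -> R) r t :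
  measurable_fun setT (tau_up_r L z r t) -> measurable_fun setT (tau_dn_r L z r t) ->
  (vote_P_decide1 P L z r t t <= 2%:E * P [set w | (tau_up_r L z r t w < +oo)%E])%E.
Proof.
move=> mup mdn.
have mcst : measurable_fun [set: Omega] (cst +oo%E : Omega -> \bar R) by [].
have m1 : measurable [set w | (tau_up_r L z r t w < +oo)%E].
  by rewrite -[X in measurable X]setTI; exact: measurable_lte.
have m2 : measurable [set w | (tau_up_r L z r t w < tau_dn_r L z r t w)%E].
  by rewrite -[X in measurable X]setTI; exact: measurable_lte.
have m3 : measurable [set w | tau_up_r L z r t w = tau_dn_r L z r t w].
  by rewrite -[X in measurable X]setTI; exact: measurable_eqe.
rewrite (_ : 2%:E = 1 + 1)%E // ge0_muleDl// !mul1e; apply: leeD.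
  apply: le_measure; rewrite ?inE// => w /= /lt_le_trans; apply; exact: leey.
apply: (@le_trans _ _ (1 * P [set w | (tau_up_r L z r t w < +oo)%E])%E); last by rewrite mul1e.
apply: lee_pmul => //.
- by rewrite lee_fin invf_le1// ler1n.
- by apply: le_measure; rewrite ?inE//; [exact: measurableI|move=> w []].
Qed.

Lemma vote_decide0E (P : probability Omega R) L (z : 'I_s -> nat -> Omega -> R) r t :
  vote_P_decide0 P L z r t t = vote_P_decide1 P (reciprocal L) z r t t.
Proof.
have upE : tau_up_r (reciprocal L) z r t = tau_dn_r L z r t.
  by apply/funext => w; exact: tau_up_rV.
have dnE : tau_dn_r (reciprocal L) z r t = tau_up_r L z r t.
  by apply/funext => w; exact: tau_dn_rV.
rewrite /vote_P_decide0 /vote_P_decide1 upE dnE; congr (_ + _ * P _)%E.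
by apply/seteqP; split=> w /= [-> ?].
Qed.

Lemma vote_TV L (z : 'I_s -> nat -> Omega -> R) r t w :
  vote_T (reciprocal L) z r t t w = vote_T L z r t t w.
Proof. by rewrite /vote_T tau_up_rV tau_dn_rV minC. Qed.

End Model.

(** The losses in [lam] and [delta] are small enough that [(q * I - eps) / (I - delta) < lam * q];
    for large [t] this gap in slope absorbs the constants [K] and [C]. *)
Lemma exponent_comparison (R : realType) (q I eps : R) : 0 < q -> 0 < I -> 0 < eps ->
  exists lam delta, [/\ 0 < lam < 1, 0 < delta < I &
    forall K C, \forall t \near +oo, forall D, 0 <= D <= t / (I - delta) + C ->
      K * expR (- (lam * q * t)) <= expR (- ((q * I - eps) * D))].
Proof.
move=> q0 I0 eps0; pose eta := Num.min (1 / 2) (eps / (4 * (q * I))).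
have qI0 : 0 < q * I by exact: mulr_gt0.
have eta0 : 0 < eta by rewrite lt_min; apply/andP; split; [lra|apply: divr_gt0 => //; lra].
have eta2 : eta <= 1 / 2 by rewrite ge_min lexx.
have etaE : eta * (4 * (q * I)) <= eps.
  by rewrite -ler_pdivlMr; [rewrite ge_min lexx orbT|lra].
exists (1 - eta), (eta * I); split; [lra|nra|] => K C.
have Id0 : 0 < I - eta * I by nra.
(* The positive part, because [q * I - eps] may be negative and only an upper bound on [D] is at
   hand. *)
pose c' := Num.max (q * I - eps) 0.
have c'0 : 0 <= c' by rewrite le_max lexx orbT.
pose slope := (1 - eta) * q - c' / (I - eta * I).
have slope0 : 0 < slope.
  rewrite subr_gt0 ltr_pdivrMr// /c' gt_max; apply/andP; split; last by rewrite !mulr_gt0//; lra.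
  have : 0 <= eta * eta * (q * I) by rewrite !mulr_ge0// ltW.
  have : 0 < eta * (q * I) by rewrite mulr_gt0.
  nra.
near=> t => D /andP[D0 DC].
have t1 : (c' * C + K) / slope <= t by near: t; apply: nbhs_pinfty_ge; rewrite num_real.
(* The bound [K <= expR K] moves the constant into the exponent, whatever its sign. *)
apply: (@le_trans _ _ (expR K * expR (- ((1 - eta) * q * t)))).
  rewrite ler_wpM2r ?expR_ge0//; apply: le_trans (expR_ge1Dx K); lra.
rewrite -expRD ler_expR; move: t1; rewrite ler_pdivrMr// /slope mulrBr.
have : (q * I - eps) * D <= c' * (t / (I - eta * I) + C).
  apply: (@le_trans _ _ (c' * D)); last by rewrite ler_wpM2l.
  by rewrite ler_wpM2r// le_max lexx.
rewrite mulrDr [t * (c' / _)]mulrCA; lra.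
Unshelve. all: by end_near. Qed.

Lemma fine_integralN d (T : measurableType d) (R : realType)
    (m : {measure set T -> \bar R}) (f : T -> R) :
  m.-integrable setT (fun y => (f y)%:E) ->
  fine (\int[m]_y (- f y)%:E)%E = - fine (\int[m]_y (f y)%:E)%E.
Proof.
move=> intf; rewrite -fineN; congr fine.
by rewrite -integralN//; exact: integrable_add_def intf.
Qed.

Section HonestSensors.
Context {R : realType} {d : measure_display} {Omega : measurableType d} {s : nat}.
Variables (P : probability Omega R) (nu : probability R R) (L : R -> R).
Variables (x : 'I_s -> nat -> Omega -> R).
Hypothesis mL : measurable_fun setT L.
Hypothesis mx : forall i n, measurable_fun setT (x i n).
Hypothesis lawx : forall i n A, measurable A -> P (x i n @^-1` A) = nu A.
Hypothesis indx : mutually_independent P (fun j : 'I_s * nat => x j.1 j.2).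

(** The exponential of the sums is a product over the pairs [(i, n)] with [n < f i], which index
    distinct independent observations; on [H] the received values are the true ones. *)
Lemma tilted_expectation (H : {set 'I_s}) (z : 'I_s -> nat -> Omega -> R)
    (k e : R) (f : 'I_s -> nat) :
  (forall i n, i \in H -> z i n = x i n) ->
  (\int[nu]_y (expR (k * llr L y))%:E = e%:E)%E ->
  (\int[P]_w (\prod_(i in H) expR (k * Ssum L z i (f i) w))%:E =
   (\prod_(i in H) e ^+ f i)%:E)%E.
Proof.
move=> zx eE; pose F := [seq (i, n) | i <- enum H, n <- iota 0 (f i)].
have uF : uniq F.
  apply: allpairs_uniq_dep => [|i _|[i n] [j m] _ _ /= [-> ->]//].
  - exact: enum_uniq.
  - exact: iota_uniq.
have mg : measurable_fun setT (fun y => expR (k * llr L y)).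
  apply: measurableT_comp => //; apply: measurable_funM => //.
  by apply: measurableT_comp => //; exact: measurable_ln.
have := @expectation_prod _ _ _ P _ (fun j => x j.1 j.2) nu _ e (fun j => mx j.1 j.2) indx
  (fun j => @lawx j.1 j.2) mg (fun=> expR_ge0 _) eE F uF.
have -> : e ^+ size F = \prod_(i in H) e ^+ f i.
  rewrite size_allpairs_dep -big_enum /=; elim: (enum H) => [|i l IH]; first by rewrite big_nil.
  by rewrite big_cons /= exprD IH size_iota.
move=> <-; apply: eq_integral => w _; congr EFin.
rewrite big_allpairs_dep /= big_enum; apply: eq_bigr => i iH.
rewrite /Ssum mulr_sumr expR_sum -(big_mkord xpredT (fun n => expR (k * llr L (z i n w)))).
by rewrite /index_iota subn0; apply: eq_bigr => n _; rewrite zx.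
Qed.

End HonestSensors.

(** Stated for one hypothesis, with [nu] as the true law and [1] as the wrong decision, so that it
    applies to both states. The constants [K] and [C0] do not depend on [t]. *)
Lemma voting_rule_bounds (R : realType) (s : nat) (C : {set 'I_s})
  (mu nu : probability R R) (L : R -> R)
  (d : measure_display) (Omega : measurableType d) (P : probability Omega R)
  (x z : 'I_s -> nat -> Omega -> R) (delta lam : R) :
  (forall A, measurable A -> mu A = 0%E -> nu A = 0%E) ->
  is_RN_deriv mu nu L ->
  mu.-integrable setT (fun y => (llr L y)%:E) ->
  nu.-integrable setT (fun y => (llr L y)%:E) ->
  (forall i k, measurable_fun setT (x i k)) ->
  (forall i k A, measurable A -> P (x i k @^-1` A) = nu A) ->
  mutually_independent P (fun j : 'I_s * nat => x j.1 j.2) ->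
  (forall i k, measurable_fun setT (z i k)) ->
  (forall i k, i \notin C -> z i k = x i k) ->
  0 < lam < 1 ->
  let I := Num.min (fine (\int[mu]_y (llr L y)%:E))
                   (- fine (\int[nu]_y (llr L y)%:E)) in
  0 < delta < I ->
  let r := (s - #|C|)%N in
  exists K C0 : R, forall t, 0 <= t ->
    (vote_P_decide1 P L z r t t <= (K * expR (- (lam * (s - 2 * #|C|)%:R * t)))%:E)%E /\
    (\int[P]_w vote_T L z r t t w <= (t / (I - delta) + C0)%:E)%E.
Proof.
move=> nu_mu LE imu inu mx lawx indx mz zx /andP[lam0 lam1] I /andP[delta0 deltaI] r.
have [mL [L0 _]] := LE; have ml := measurable_llr _ _ _ _ LE.
have tilt_nu := @small_tilt _ _ _ nu (llr L) inu.
rewrite (expectation_expR_llr _ _ _ _ nu_mu LE) in tilt_nu.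
have {tilt_nu} := tilt_nu (ltry _) _ delta0.
have imuN : mu.-integrable setT (fun y => (- llr L y)%:E) by exact: integrableN imu.
have tilt_mu := @small_tilt _ _ _ mu (fun y => - llr L y) imuN.
rewrite (expectation_expR_Nllr _ _ _ _ nu_mu LE) in tilt_mu.
have {tilt_mu} := tilt_mu (ltry _) _ delta0.
have -> : fine (\int[mu]_y (- llr L y)%:E)%E = - fine (\int[mu]_y (llr L y)%:E)%E.
  exact: fine_integralN.
move=> tmu tnu.
(* A single [n] serves both tilts: [k = 1 / n.+1] controls the stopping time and [1 - k >= lam] the
   error. *)
have [n [{}tmu {}tnu nlam]] : exists n, [/\
  (\int[mu]_y (expR (- llr L y / n.+1%:R))%:E <= (1 + n.+1%:R^-1 *
    (- fine (\int[mu]_y (llr L y)%:E)%E + delta)%R)%:E)%E,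
  (\int[nu]_y (expR (llr L y / n.+1%:R))%:E <= (1 + n.+1%:R^-1 *
    (fine (\int[nu]_y (llr L y)%:E) + delta))%:E)%E & n.+1%:R^-1 <= 1 - lam].
  near \oo => n; exists n; split; [by near: n|by near: n|apply/ltW; near: n].
  by apply: cvgr_lt; [exact: cvg_harmonic|rewrite subr_gt0].
set k := n.+1%:R^-1 in tmu tnu nlam; have k0 : 0 < k by rewrite invr_gt0.
have Id0 : 0 < k * (I - delta) by rewrite mulr_gt0// subr_gt0.
(* Both means are at most [- I], so either moment is at most [1 - k * (I - delta) < 1]. *)
have bound f (m : probability R R) B : B + I <= 0 -> measurable_fun setT f ->
    (\int[m]_y (expR (f y))%:E <= (1 + k * (B + delta))%:E)%E ->
  exists e, [/\ (\int[m]_y (expR (f y))%:E = e%:E)%E, 0 <= e < 1 & e <= 1 - k * (I - delta)].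
  move=> BI mf fB; have f0 : (0 <= \int[m]_y (expR (f y))%:E)%E.
    by apply: integral_ge0 => y _; rewrite lee_fin expR_ge0.
  have ffin : (\int[m]_y (expR (f y))%:E)%E \is a fin_num.
    by rewrite ge0_fin_numE// (le_lt_trans fB)// ltry.
  exists (fine (\int[m]_y (expR (f y))%:E)%E); rewrite fineK//.
  have h : fine (\int[m]_y (expR (f y))%:E)%E <= 1 - k * (I - delta).
    rewrite -lee_fin fineK//; apply: le_trans fB _; rewrite lee_fin lerD2l -mulrN ler_pM2l//; lra.
  by split=> //; rewrite fine_ge0//=; lra.
have Imu : - fine (\int[mu]_y (llr L y)%:E)%E + I <= 0.
  by rewrite addrC subr_le0 ge_min lexx.
have Inu : fine (\int[nu]_y (llr L y)%:E)%E + I <= 0.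
  by rewrite -lerBrDl sub0r ge_min lexx orbT.
have mlk : measurable_fun setT (fun y => llr L y * k) by exact: measurable_funM.
have mNlk : measurable_fun setT (fun y => - llr L y * k).
  by apply: measurable_funM => //; exact: measurableT_comp.
have [e1 [e1E e101 e1k]] := bound _ _ _ Inu mlk tnu.
have [e2 [e2E e201 _]] := bound _ _ _ Imu mNlk tmu.
have {}e1E : (\int[nu]_y (expR (k * llr L y))%:E = e1%:E)%E.
  by rewrite -e1E; apply: eq_integral => y _; rewrite mulrC.
have {}e2E : (\int[nu]_y (expR ((1 - k) * llr L y))%:E = e2%:E)%E.
  rewrite -(tilt_duality _ _ _ _ nu_mu LE) -e2E.
  by apply: eq_integral => y _; rewrite mulNr mulrC.
pose H := ~: C; have zH i m : i \in H -> z i m = x i m.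
  by rewrite finset.in_setC => /zx.
have tilt1 f := tilted_expectation P nu L x mL mx lawx indx H z k e1 f zH e1E.
have tilt2 f := tilted_expectation P nu L x mL mx lawx indx H z (1 - k) e2 f zH e2E.
have k1 : 0 < 1 - k by lra.
have cardH : #|H| = r by rewrite cardsCs finset.setCK card_ord.
exists (2 * (1 - e2)^-1 ^+ #|H|), (1 + #|H|%:R * (1 - e1)^-1) => t t0; split.
- apply: (le_trans (vote_decide1_le _ _ _ _ _ _ _)).
    exact: measurable_tau_up_r.
    exact: measurable_tau_dn_r.
  have := tau_up_fin_le P L z H (1 - k) e2 mL mz k1 e201 tilt2 r t t0.
  (* The attacker can cast [#|C|] of the [s - #|C|] votes, which leaves [s - 2 * #|C|] honest
     ones. *)
  rewrite finset.setCK /r -subnDA addnn -mul2n => h.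
  apply: (le_trans (lee_wpmul2l _ h)) => //.
  rewrite -EFinM lee_fin [expR _ * _]mulrC mulrA ler_wpM2l//.
    by rewrite mulr_ge0// exprn_ge0// invr_ge0 subr_ge0 ltW//; case/andP: e201.
  by rewrite ler_expR lerN2 ler_wpM2r// ler_wpM2r//; lra.
- apply: (@le_trans _ _ (\int[P]_w tau_dn_r L z r t w)%E).
    have mdn := measurable_tau_dn_r L z r t mL mz.
    have mup := measurable_tau_up_r L z mL mz r t.
    have tau_ge0 (A : set nat) : (0 <= ereal_inf [set (m%:R : R)%:E | m in A])%E.
      by apply: le_ereal_inf_tmp => _ [m _ <-]; rewrite lee_fin.
    apply: ge0_le_integral => //.
    - by move=> w _; rewrite /vote_T le_min !tau_ge0.
    - exact: measurable_mine.
    - by move=> w _; rewrite /vote_T ge_min lexx.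
  (* The first integer above [t / (I - delta)], the time by which the drift [- (I - delta)] leads to
     [- t]. *)
  pose n0 := (Num.truncn (t / (I - delta))).+1.
  have tn0 : t / (I - delta) < n0%:R by exact: truncnS_gt.
  have n0t : n0%:R <= t / (I - delta) + 1.
    rewrite -natr1 lerD2r truncn_le//; apply: divr_ge0 => //; lra.
  have [e10 e11] := andP e101.
  have e1n0 : expR (k * t) * e1 ^+ n0 <= 1.
    apply: (@le_trans _ _ (expR (k * t) * expR (- (k * (I - delta))) ^+ n0)).
      rewrite ler_wpM2l ?expR_ge0//; apply: lerXn2r; rewrite ?nnegrE ?expR_ge0//.
      by apply: (le_trans e1k); exact: expR_ge1Dx.
    rewrite -expRM_natr -expRD -[leRHS]expR0 ler_expR.
    move: tn0; rewrite ltr_pdivrMr; last lra.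
    move=> tn0; have : k * t <= k * (n0%:R * (I - delta)) by rewrite ler_wpM2l// ltW.
    lra.
  have := integral_tau_dn_le P L z H k e1 mL mz k0 e101 tilt1 r t n0.
  rewrite cardH => /(_ (leqnn _) isT) /le_trans; apply; rewrite lee_fin.
  rewrite addrA lerD// -[_ * _ * _ ^+ _]mulrA mulrAC -[leRHS]mulr1 ler_wpM2l//.
  by rewrite mulr_ge0// invr_ge0 subr_ge0 ltW.
Unshelve. all: by end_near. Qed.

(** The rate is expressed without a logarithm or a limit: up to [eps], the exponent of the larger
    error is at least [(s - 2 * c) * I] times the expected delay. The maximum covers the families
    with equal errors, and the index of [xa] lets the attack depend on the state. *)
Theorem theorem3 (R : realType) (s c : nat) (C : {set 'I_s})
  (mu nu : probability R R) (L : R -> R)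
  (d : measure_display) (Omega : measurableType d)
  (P : bool -> probability Omega R)
  (x : 'I_s -> nat -> Omega -> R) (U : Omega -> R)
  (xa : bool -> nat -> Omega -> 'I_s -> R) :
  (* mu, nu mutually absolutely continuous, L = d mu / d nu *)
  (forall A, measurable A -> nu A = 0%E -> mu A = 0%E) ->
  (forall A, measurable A -> mu A = 0%E -> nu A = 0%E) ->
  is_RN_deriv mu nu L ->
  (* 0 < I_0, I_1 < oo *)
  mu.-integrable setT (fun y => (llr L y)%:E) ->
  nu.-integrable setT (fun y => (llr L y)%:E) ->
  (0 < \int[mu]_y (llr L y)%:E)%E ->
  (0 < - \int[nu]_y (llr L y)%:E)%E ->
  (* observation model under P_theta *)
  (forall i k, measurable_fun setT (x i k)) ->
  (forall i k A, measurable A -> P false (x i k @^-1` A) = nu A) ->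
  (forall i k A, measurable A -> P true (x i k @^-1` A) = mu A) ->
  measurable_fun setT U ->
  (forall th, mutually_independent (P th) (obs_family x U)) ->
  (* attack model *)
  #|C| = c ->
  (forall th, admissible_attack C x U (xa th)) ->
  (2 * c < s)%N ->
  let I := Num.min (fine (\int[mu]_y (llr L y)%:E))
                   (- fine (\int[nu]_y (llr L y)%:E)) in
  let r := (s - c)%N in
  let alpha t := vote_P_decide1 (P false) L (received x (xa false)) r t t in
  let beta t := vote_P_decide0 (P true) L (received x (xa true)) r t t in
  let D t := Order.max
      (\int[P false]_w vote_T L (received x (xa false)) r t t w)%E
      (\int[P true]_w vote_T L (received x (xa true)) r t t w)%E in
  forall eps : R, 0 < eps ->
  \forall t \near +oo%R,
    (D t < +oo)%E /\
    fine (Order.max (alpha t) (beta t)) <=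
      expR (- (((s - 2 * c)%:R * I - eps) * fine (D t))).
Proof.
move=> mu_nu nu_mu LE imu inu Imu0 Inu0 mx law0 law1 mU ind Cc adm cs I r alpha beta D eps eps0.
have ciq : (s - 2 * c = s - 2 * #|C|)%N by rewrite Cc.
have rE : r = (s - #|C|)%N by rewrite /r Cc.
have [mL _] := LE.
have fin_mu : (\int[mu]_y (llr L y)%:E)%E \is a fin_num by exact: integrable_fin_num imu.
have fin_nu : (\int[nu]_y (llr L y)%:E)%E \is a fin_num by exact: integrable_fin_num inu.
have I0 : 0 < I.
  rewrite lt_min -!lte_fin EFinN !fineK//; exact/andP.
have q0 : 0 < (s - 2 * c)%:R :> R by rewrite ltr0n subn_gt0.
have [lam [delta [lam01 deltaI cmp]]] := exponent_comparison _ _ _ _ q0 I0 eps0.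
have mz th i k : measurable_fun setT (received x (xa th) i k).
  exact: measurable_received mx mU (adm th).
have zx th i k : i \notin C -> received x (xa th) i k = x i k.
  by case: (adm th) => adm0 _ iC; apply/funext => w; rewrite /received adm0// addr0.
have indx th := mutually_independent_obs (P th) x U (ind th).
have [K0 [C0 bound0]] := voting_rule_bounds R s C mu nu L d Omega (P false) x
  (received x (xa false)) delta lam nu_mu LE imu inu mx law0 (indx false)
  (mz false) (zx false) lam01 deltaI.
have llrVE : llr (reciprocal L) = fun y => - llr L y by apply/funext => y; exact: llrV.
have imuV : mu.-integrable setT (fun y => (llr (reciprocal L) y)%:E).
  by rewrite llrVE; exact: integrableN imu.
have inuV : nu.-integrable setT (fun y => (llr (reciprocal L) y)%:E).
  by rewrite llrVE; exact: integrableN inu.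
(* The exchange of [mu] and [nu] swaps [I_0] and [I_1] and keeps their minimum, so the same [delta]
   and [lam] serve both states. *)
have IV : Num.min (fine (\int[nu]_y (llr (reciprocal L) y)%:E))
    (- fine (\int[mu]_y (llr (reciprocal L) y)%:E)) = I.
  by rewrite llrVE !fine_integralN// opprK minC.
have := voting_rule_bounds R s C nu mu (reciprocal L) d Omega (P true) x
  (received x (xa true)) delta lam mu_nu
  (is_RN_deriv_reciprocal R mu nu L nu_mu LE) inuV imuV mx law1 (indx true) (mz true)
  (zx true) lam01.
rewrite IV => /(_ deltaI) [K1 [C1 bound1]].
near=> t.
have t0 : 0 <= t by near: t; apply: nbhs_pinfty_ge; rewrite num_real.
have [a0 d0] := bound0 t t0; have [a1 d1] := bound1 t t0.
rewrite -!rE -!ciq in a0 d0 a1 d1.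
have alphaK : (alpha t <= (Num.max K0 K1 * expR (- (lam * (s - 2 * c)%:R * t)))%:E)%E.
  by apply: (le_trans a0); rewrite lee_fin ler_wpM2r ?expR_ge0// le_max lexx.
have betaK : (beta t <= (Num.max K0 K1 * expR (- (lam * (s - 2 * c)%:R * t)))%:E)%E.
  rewrite /beta vote_decide0E; apply: (le_trans a1).
  by rewrite lee_fin ler_wpM2r ?expR_ge0// le_max lexx orbT.
have DC : (D t <= (t / (I - delta) + Num.max C0 C1)%:E)%E.
  rewrite ge_max; apply/andP; split.
    by apply: (le_trans d0); rewrite lee_fin lerD2l le_max lexx.
  under eq_integral do rewrite -vote_TV.
  by apply: (le_trans d1); rewrite lee_fin lerD2l le_max lexx orbT.
have D0 : (0 <= D t)%E.
  rewrite le_max; apply/orP; left; apply: integral_ge0 => w _.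
  by rewrite le_min; apply/andP; split; apply: le_ereal_inf_tmp => _ [m _ <-]; rewrite lee_fin.
have Dfin : (D t < +oo)%E by rewrite (le_lt_trans DC)// ltry.
have fD : D t \is a fin_num by rewrite ge0_fin_numE.
split=> //.
have D0C : 0 <= fine (D t) <= t / (I - delta) + Num.max C0 C1.
  by rewrite -!lee_fin fineK// D0.
have maxK : (Order.max (alpha t) (beta t) <=
    (Num.max K0 K1 * expR (- (lam * (s - 2 * c)%:R * t)))%:E)%E.
  by rewrite ge_max alphaK.
have max0 : (0 <= Order.max (alpha t) (beta t))%E.
  by rewrite le_max; apply/orP; left; rewrite adde_ge0// mule_ge0// lee_fin invr_ge0.
have cmpt : forall D : R, 0 <= D <= t / (I - delta) + Num.max C0 C1 ->
    Num.max K0 K1 * expR (- (lam * (s - 2 * c)%:R * t)) <=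
    expR (- (((s - 2 * c)%:R * I - eps) * D)).
  by near: t; exact: cmp.
apply: le_trans (cmpt _ D0C).
by rewrite -lee_fin fineK// ge0_fin_numE// (le_lt_trans maxK)// ltry.
Unshelve. all: by end_near. Qed.
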